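(* There exists a constant $c>0$ such that, for every generic set $P$ of $n$ points in the plane, $\operatorname{cr}(P) < cn$.
   Context: A finite planar point set is in general position if no three of its points are collinear. It is generic if it is in general position and every subset of it has a unique (Euclidean) minimum spanning tree (MST); for a generic set $X$, $T_X$ denotes the MST of $X$ (the complete graph on $X$ with edges drawn as straight segments weighted by Euclidean length). For disjoint point sets $R,B$ with $R\cup B$ generic, $\operatorname{cr}(R,B)$ denotes the number of crossings between the straight-line edges of $T_R$ and the straight-line edges of $T_B$. For a generic point set $P$, the bicolored MST crossing number is $\operatorname{cr}(P)=\max \operatorname{cr}(R,B)$, the maximum over all partitions (colorings) $P=R\cup B$ into two disjoint sets. *)

(* Defs.v *)
From Stdlib Require Import Reals.
From mathcomp Require Import all_boot.
From mathcomp Require Import boolp.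

Set Implicit Arguments.
Unset Strict Implicit.
Unset Printing Implicit Defensive.

Definition point := (R * R)%type.

Definition orient (a b c : point) : R :=
  Rminus (Rmult (Rminus (fst b) (fst a)) (Rminus (snd c) (snd a)))
         (Rmult (Rminus (snd b) (snd a)) (Rminus (fst c) (fst a))).

Definition collinear (a b c : point) : Prop := orient a b c = R0.

Definition edist (a b : point) : R :=
  sqrt (Rplus (Rsqr (Rminus (fst a) (fst b))) (Rsqr (Rminus (snd a) (snd b)))).

Definition segs_meet (a b c d : point) : Prop :=
  exists s t : R, Rle R0 s /\ Rle s R1 /\ Rle R0 t /\ Rle t R1 /\
    Rplus (fst a) (Rmult s (Rminus (fst b) (fst a)))
      = Rplus (fst c) (Rmult t (Rminus (fst d) (fst c))) /\
    Rplus (snd a) (Rmult s (Rminus (snd b) (snd a)))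
      = Rplus (snd c) (Rmult t (Rminus (snd d) (snd c))).

Section Graphs.
Variable n : nat.
Variable p : 'I_n -> point.

(* A geometric graph on the indices: a set of edges, each edge a 2-element set. *)
Definition edge_rel (T : {set {set 'I_n}}) : rel 'I_n :=
  fun u v => [set u; v] \in T.

Definition spanning_tree (X : {set 'I_n}) (T : {set {set 'I_n}}) : Prop :=
  (forall e, e \in T -> #|e| = 2 /\ e \subset X) /\
  #|T| = (#|X|).-1 /\
  (forall x y, x \in X -> y \in X -> connect (edge_rel T) x y).

Definition edge_pairs (T : {set {set 'I_n}}) : seq ('I_n * 'I_n) :=
  enum [set uv : 'I_n * 'I_n | (uv.1 < uv.2)%N && ([set uv.1; uv.2] \in T)].

Definition weight (T : {set {set 'I_n}}) : R :=
  foldr Rplus R0 [seq edist (p uv.1) (p uv.2) | uv <- edge_pairs T].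

Definition is_MST (X : {set 'I_n}) (T : {set {set 'I_n}}) : Prop :=
  spanning_tree X T /\
  forall T', spanning_tree X T' -> Rle (weight T) (weight T').

(* General position: no three distinct points collinear (and the points are
   distinct, so that p indexes a set of n points). *)
Definition general_position : Prop :=
  injective p /\
  forall i j k : 'I_n, i != j -> j != k -> i != k ->
    ~ collinear (p i) (p j) (p k).

Definition generic : Prop :=
  general_position /\
  forall (X : {set 'I_n}) T1 T2, is_MST X T1 -> is_MST X T2 -> T1 = T2.

Definition crossings (TR TB : {set {set 'I_n}}) : nat :=
  #|[set q : ('I_n * 'I_n) * ('I_n * 'I_n) |
      [&& (q.1.1 < q.1.2)%N, [set q.1.1; q.1.2] \in TR,
          (q.2.1 < q.2.2)%N, [set q.2.1; q.2.2] \in TB &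
          `[< segs_meet (p q.1.1) (p q.1.2) (p q.2.1) (p q.2.2) >] ]]|.

End Graphs.

(* Main.v *)
(* Charge each crossing to the shorter of its two edges; it suffices that an
   edge e of one tree meets boundedly many edges of the other tree that are at
   least as long as e.  Sort these edges into boundedly many classes by the
   position of the crossing point on e, by direction, and by which endpoint is
   nearer to the crossing point.  If two edges ab and cd fell in the same class,
   then both ac and bd would be too short for the exchange property of minimum
   spanning trees: |ab| and |cd| are each at most max(|ac|, |bd|). *)
Require Import Defs.
From Stdlib Require Import Reals ZArith Lra Lia.
From HB Require Import structures.
From mathcomp Require Import all_boot.
From mathcomp Require Import boolp.

Set Implicit Arguments.
Unset Strict Implicit.
Unset Printing Implicit Defensive.

(* MathComp has taken over the key %R. *)
Delimit Scope R_scope with Re.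

(** Makes the big-operator lemmas available for tree weights, so that a single edge can be split off
    a sum. *)
HB.instance Definition _ :=
  Monoid.isComLaw.Build R R0 Rplus
    (fun x y z => esym (Rplus_assoc x y z)) Rplus_comm Rplus_0_l.

(** * Connectivity in edge sets *)

Section EdgeSets.
Variable n : nat.
Implicit Types (G T : {set {set 'I_n}}) (S X : {set 'I_n}).

Lemma edge_rel_sym T : symmetric (edge_rel T).
Proof. by move=> u v; rewrite /edge_rel setUC. Qed.

Lemma connect_edge_sym T : connect_sym (edge_rel T).
Proof. exact: sym_connect_sym (@edge_rel_sym T). Qed.

Lemma connect_edge_sub G T x y :
  G \subset T -> connect (edge_rel G) x y -> connect (edge_rel T) x y.
Proof.
move=> /subsetP GT; apply: connect_sub => u v uv.
by apply: connect1; apply: GT.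
Qed.

Lemma connect_invariant T (P : pred 'I_n) x y :
  (forall u v, P u -> [set u; v] \in T -> P v) ->
  P x -> connect (edge_rel T) x y -> P y.
Proof.
move=> PT Px /connectP[s + ->]; elim: s x Px => //= z s IHs x Px /andP[xz].
by apply: IHs; apply: PT xz.
Qed.

(** Explore from [a]: each vertex added to the explored set [S] brings a new edge inside [S], so
    vertices never outnumber edges by more than one. The induction is on a bound [k] for the number
    of unexplored vertices. *)
Lemma connected_card G X a :
  (forall x, x \in X -> connect (edge_rel G) a x) -> #|X| <= #|G|.+1.
Proof.
move=> conn.
suff H k S : #|~: S| <= k -> a \in S -> #|S| <= #|[set e in G | e \subset S]|.+1 ->
    #|X| <= #|G|.+1.
  by apply: (H _ [set a] (leqnn _)); rewrite ?inE // cards1.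
elim: k S => [|k IHk] S Sk aS cS.
  move: Sk; rewrite leqn0 cards_eq0 -setCT (inj_eq (can_inj (@setCK _))) => /eqP ST.
  apply: leq_trans (leq_trans (subset_leq_card _) cS) _.
    by rewrite ST subsetT.
  by rewrite ltnS subset_leq_card //; apply/subsetP=> e /[!inE]/andP[].
have [/subset_leq_card XS|/subsetPn[x xX xS]] := boolP (X \subset S).
  apply: leq_trans XS (leq_trans cS _).
  by rewrite ltnS subset_leq_card //; apply/subsetP=> e /[!inE]/andP[].
(* If no edge left [S], then [S] would be closed under [G] and so contain [x]. *)
have /existsP[z /existsP[w /and3P[zS wS zw]]] :
    [exists z, exists w, [&& z \in S, w \notin S & [set z; w] \in G]].
  apply: contraT => nex; case/negP: xS.
  apply: connect_invariant (conn x xX) => // u v uS uv.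
  apply: contraNT nex => vS.
  by apply/existsP; exists u; apply/existsP; exists v; rewrite [u \in S]uS vS uv.
apply: (IHk (w |: S)); last 2 first.
- by rewrite !inE aS orbT.
- rewrite cardsU1 wS add1n ltnS; apply: leq_trans cS _.
  have zwS : [set z; w] \notin [set e in G | e \subset S].
    by rewrite inE subUset !sub1set (negPf wS) !andbF.
  rewrite -[_.+1]add1n -[1]/(true : nat) -{1}zwS -cardsU1 subset_leq_card //.
  apply/subsetP=> e; rewrite !inE => /orP[/eqP->|/andP[-> eS]].
    by rewrite zw subUset !sub1set !inE zS eqxx orbT.
  by rewrite (subset_trans eS) ?subsetUr.
- have : #|~: S| = #|~: (w |: S)|.+1.
    by rewrite (cardsD1 w) inE wS setCU setIC setDE.
  by move: Sk => /[swap] ->.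
Qed.

(** Follow a path from [a]: a step along the deleted edge lands on [a] or [b], and any other step
    survives the deletion. *)
Lemma connect_setD1 T a b x : connect (edge_rel T) a x ->
  connect (edge_rel (T :\ [set a; b])) a x ||
  connect (edge_rel (T :\ [set a; b])) b x.
Proof.
set G := _ :\ _; pose P y := connect (edge_rel G) a y || connect (edge_rel G) b y.
apply: (@connect_invariant T P); last by rewrite /P connect0.
move=> y z yab yzT.
have [E|ne] := eqVneq [set y; z] [set a; b].
  have : z \in [set a; b] by rewrite -E !inE eqxx orbT.
  by rewrite /P !inE => /orP[]/eqP->; rewrite connect0 ?orbT.
have yz : connect (edge_rel G) y z.
  by apply: connect1; rewrite /edge_rel in_setD1 ne.
by rewrite /P; case/orP: yab => h; rewrite (connect_trans h yz) ?orbT.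
Qed.

End EdgeSets.

(** * Distances, tree weights and the exchange property *)

Lemma edist_sym a b : edist a b = edist b a.
Proof. exact: distance_symm. Qed.

Lemma edist_pos a b : a <> b -> (0 < edist a b)%Re.
Proof.
move=> ab; apply: sqrt_lt_R0.
case: (Req_dec (fst a) (fst b)) => [e1|]; last first.
  move=> ne; have := Rlt_0_sqr _ (Rminus_eq_contra _ _ ne).
  have := Rle_0_sqr (snd a - snd b)%Re; lra.
case: (Req_dec (snd a) (snd b)) => [e2|ne].
  by case: a b ab e1 e2 => [? ?] [? ?] /= ab *; case: ab; congr pair.
have := Rlt_0_sqr _ (Rminus_eq_contra _ _ ne).
have := Rle_0_sqr (fst a - fst b)%Re; lra.
Qed.

Section Exchange.
Variables (n : nat) (p : 'I_n -> point).
Implicit Types (G T : {set {set 'I_n}}) (X : {set 'I_n}).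

Lemma weightE T :
  weight p T = \big[Rplus/R0]_(uv : 'I_n * 'I_n | (uv.1 < uv.2) && ([set uv.1; uv.2] \in T))
                 edist (p uv.1) (p uv.2).
Proof.
rewrite /weight foldrE big_map big_enum /=.
by apply: eq_bigl => uv; rewrite inE.
Qed.

Lemma set2_ltn_inj (i j k l : 'I_n) :
  i < j -> k < l -> [set i; j] = [set k; l] -> (i, j) = (k, l).
Proof.
move=> ij kl /setP E.
have := E i; have := E j; rewrite !inE !eqxx ?orbT => /esym Ej /esym Ei.
case/orP: Ei Ej => /eqP Ei /orP[] /eqP Ej; subst=> //.
- by rewrite ltnn in ij.
- by have := ltn_trans ij kl; rewrite ltnn.
- by rewrite ltnn in ij.
Qed.

Lemma weightU1 G u v : u != v -> [set u; v] \notin G ->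
  weight p ([set u; v] |: G) = Rplus (edist (p u) (p v)) (weight p G).
Proof.
(* The weight lists each edge as an increasing pair, so the unordered edge is oriented first. *)
wlog uv : u v / u < v => [hwlog uv uvG|_ uvG].
  have [lt|gt|/val_inj eq] := ltngtP u v; first exact: hwlog.
    by rewrite (setUC [set u]) edist_sym hwlog // 1?(setUC [set v]) // eq_sym.
  by rewrite eq eqxx in uv.
rewrite !weightE (bigD1 (u, v)) /=; last by rewrite uv !inE eqxx.
congr Rplus; apply: eq_bigl => -[i j] /=; rewrite !inE.
have [ij|] //= := boolP (i < j).
have [[-> ->]|ne] := eqVneq (i, j) (u, v).
  by rewrite eqxx (negPf uvG) andbF.
rewrite andbT; case: eqP => // /(set2_ltn_inj ij uv) E.
by rewrite E eqxx in ne.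
Qed.

(** Replacing [ab] by [uv] rejoins the two components and gives another spanning tree, which cannot
    be lighter. *)
Lemma MST_cut X T a b u v : is_MST p X T -> [set a; b] \in T ->
  u \in X -> v \in X ->
  connect (edge_rel (T :\ [set a; b])) a u ->
  connect (edge_rel (T :\ [set a; b])) b v ->
  (edist (p a) (p b) <= edist (p u) (p v))%Re.
Proof.
move=> [[Tsub [Tcard Tconn]] Tmin] abT uX vX.
set G := T :\ [set a; b] => au bv.
have [ab2 abX] := Tsub _ abT.
have aX : a \in X by apply: (subsetP abX); rewrite !inE eqxx.
have ab : a != b by move: ab2; rewrite cards2; case: (a != b).
have Gab x : x \in X -> connect (edge_rel G) a x || connect (edge_rel G) b x.
  by move=> xX; apply/connect_setD1/Tconn.
have cardT : #|T| = #|G|.+1 by rewrite (cardsD1 [set a; b]) abT.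
(* Otherwise [G] would connect all of [X] with only [#|X| - 2] edges. *)
have Nab : ~~ connect (edge_rel G) a b.
  apply/negP=> cab.
  have /connected_card : forall x, x \in X -> connect (edge_rel G) a x.
    by move=> x /Gab/orP[//|]; apply: connect_trans.
  have : 0 < #|X| by apply/card_gt0P; exists a.
  by move: Tcard; rewrite cardT; case: #|X| => //= m <-; rewrite ltnn.
have Nuv : ~~ connect (edge_rel G) u v.
  apply: contra Nab => cuv; apply: connect_trans au _.
  by apply: connect_trans cuv _; rewrite connect_edge_sym.
have uv : u != v by apply: contraNneq Nuv => ->; rewrite connect0.
have uvG : [set u; v] \notin G.
  by apply: contra Nuv => uvG; apply: connect1.
have GT' : G \subset [set u; v] |: G by exact: subsetUr.
have T'a x : x \in X -> connect (edge_rel ([set u; v] |: G)) a x.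
  case/Gab/orP; first exact: connect_edge_sub.
  move/(connect_edge_sub GT'); apply: connect_trans.
  apply: connect_trans (connect_edge_sub GT' au) _.
  apply: (@connect_trans _ _ v); last first.
    by rewrite connect_edge_sym; apply: connect_edge_sub bv.
  by apply: connect1; rewrite /edge_rel setU11.
have /Tmin : spanning_tree X ([set u; v] |: G).
  split; [|split].
  - move=> e; rewrite !inE => /orP[/eqP->|/andP[_ /Tsub//]].
    by rewrite cards2 uv subUset !sub1set uX vX.
  - by rewrite cardsU1 uvG add1n -cardT.
  - move=> x y xX yX; apply: connect_trans (T'a y yX).
    by rewrite connect_edge_sym T'a.
have -> : T = [set a; b] |: G by rewrite setD1K.
rewrite !weightU1 //; last by rewrite !inE eqxx.
lra.
Qed.

(** Delete [ab]. If [c] is on the side of [b], then [ac] spans the cut; if it is on the side of [a],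
    the surviving edge [cd] puts [d] there too, and [bd] spans the cut. *)
Lemma MST_exchange X T a b c d : is_MST p X T ->
  [set a; b] \in T -> [set c; d] \in T -> [set a; b] != [set c; d] ->
  (edist (p a) (p b) <= edist (p a) (p c))%Re \/
  (edist (p a) (p b) <= edist (p b) (p d))%Re.
Proof.
move=> mst abT cdT ne.
have [[Tsub [_ Tconn]] _] := mst.
have [[_ abX] [_ cdX]] := (Tsub _ abT, Tsub _ cdT).
have [aX bX] : a \in X /\ b \in X by split; apply: (subsetP abX); rewrite !inE eqxx ?orbT.
have [cX dX] : c \in X /\ d \in X by split; apply: (subsetP cdX); rewrite !inE eqxx ?orbT.
set G := T :\ [set a; b].
have /orP[ac|bc] := connect_setD1 b (Tconn a c aX cX).
- right; rewrite (edist_sym (p b)); apply: (MST_cut mst abT) => //.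
  apply: connect_trans ac _; apply: connect1.
  by rewrite /edge_rel in_setD1 eq_sym ne.
- by left; apply: (MST_cut mst abT).
Qed.

End Exchange.

(** * Length estimates and rounding *)

Definition len (x y : R) : R := sqrt (Rsqr x + Rsqr y)%Re.

Lemma edistE a b : edist a b = len (fst a - fst b)%Re (snd a - snd b)%Re.
Proof. by []. Qed.

Lemma len_triangle x y x' y' : (len (x + x') (y + y') <= len x y + len x' y')%Re.
Proof.
(* The origin is the intermediate point between [(x, y)] and [(-x', -y')]. *)
have := triangle x y (- x') (- y') 0 0; rewrite /dist_euc /len.
rewrite !Rminus_0_r !Rminus_0_l !Ropp_involutive.
by rewrite /Rminus !Ropp_involutive.
Qed.

Lemma lenZ k x y : (0 <= k)%Re -> len (k * x)%Re (k * y)%Re = (k * len x y)%Re.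
Proof.
move=> k0; rewrite /len !Rsqr_mult -Rmult_plus_distr_l sqrt_mult.
- by rewrite sqrt_Rsqr.
- exact: Rle_0_sqr.
- by have := Rle_0_sqr x; have := Rle_0_sqr y; lra.
Qed.

Lemma lenN x y : len (- x)%Re (- y)%Re = len x y.
Proof. by rewrite /len -!Rsqr_neg. Qed.

Lemma len_bounds x y :
  (Rabs x <= len x y /\ Rabs y <= len x y /\ len x y <= Rabs x + Rabs y)%Re.
Proof.
have [x2 y2] := (Rle_0_sqr x, Rle_0_sqr y).
have [x0 y0] := (Rabs_pos x, Rabs_pos y).
split; [|split].
- by rewrite -sqrt_Rsqr_abs; apply: sqrt_le_1; lra.
- by rewrite -sqrt_Rsqr_abs; apply: sqrt_le_1; lra.
- apply: Rsqr_incr_0; [|exact: sqrt_pos|lra].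
  rewrite Rsqr_sqrt ?[Rsqr (_ + _)]/Rsqr; last lra.
  rewrite (Rsqr_abs x) (Rsqr_abs y) /Rsqr; nra.
Qed.

(** For [s' <= s], write [s u - s' v = (s - s') u + s' (u - v)] and apply the triangle
    inequality. *)
Lemma len_rays x y s s' u1 u2 v1 v2 :
  (0 <= s)%Re -> (0 <= s')%Re -> (len u1 u2 <= 1)%Re -> (len v1 v2 <= 1)%Re ->
  (len (u1 - v1) (u2 - v2) <= / 4)%Re ->
  (len (x + (s * u1 - s' * v1)) (y + (s * u2 - s' * v2))
    <= len x y + Rabs (s - s') + Rmin s s' / 4)%Re.
Proof.
wlog ss : s s' u1 u2 v1 v2 / (s' <= s)%Re => [hwlog|] s0 s'0 u v uv.
  case: (Rle_dec s' s) => ss; first exact: hwlog.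
  (* Exchanging the two rays reverses the difference; negating both directions restores it. *)
  have := (hwlog s' s (- v1) (- v2) (- u1) (- u2))%Re; rewrite !lenN Rmin_comm Rabs_minus_sym.
  replace (s * u1 - s' * v1)%Re with (s' * - v1 - s * - u1)%Re by ring.
  replace (s * u2 - s' * v2)%Re with (s' * - v2 - s * - u2)%Re by ring.
  apply; try lra.
  replace (- v1 - - u1)%Re with (u1 - v1)%Re by ring.
  by replace (- v2 - - u2)%Re with (u2 - v2)%Re by ring.
replace (s * u1 - s' * v1)%Re with ((s - s') * u1 + s' * (u1 - v1))%Re by ring.
replace (s * u2 - s' * v2)%Re with ((s - s') * u2 + s' * (u2 - v2))%Re by ring.
have t1 := (len_triangle x y
  ((s - s') * u1 + s' * (u1 - v1)) ((s - s') * u2 + s' * (u2 - v2)))%Re.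
have t2 := (len_triangle ((s - s') * u1) ((s - s') * u2)
  (s' * (u1 - v1)) (s' * (u2 - v2)))%Re.
rewrite !lenZ in t2; try lra.
rewrite Rmin_right // Rabs_pos_eq; last lra.
nra.
Qed.

(* [s, t] and [s', t'] are the distances from the crossing points to the
   endpoints of the two edges, [A] and [B] the distances between corresponding
   endpoints; both edges have their crossing point in the same half. *)
Lemma no_parallel_edges l s t s' t' A B :
  (0 < l)%Re -> (l <= s + t)%Re -> (l <= s' + t')%Re ->
  (0 <= s)%Re -> (0 <= t)%Re -> (0 <= s')%Re -> (0 <= t')%Re ->
  (A <= l / 8 + Rabs (s - s') + Rmin s s' / 4)%Re ->
  (B <= l / 8 + Rabs (t - t') + Rmin t t' / 4)%Re ->
  (s + t <= A \/ s + t <= B)%Re -> (s' + t' <= A \/ s' + t' <= B)%Re ->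
  (s <= t /\ s' <= t' \/ t <= s /\ t' <= s')%Re -> False.
Proof.
(* Use [|x - y| + min / 4 = max - 3/4 min]. In the far halves both parts are at least [l / 2], so
   the bound is below the larger part. In the near halves the larger part is at most half its edge,
   and [l / 8] is less than the other half. Hence [A] and [B] are both below the longer edge. *)
rewrite /Rabs /Rmin => ? ? ? ? ? ? ?.
by case: (Rcase_abs (s - s')); case: (Rcase_abs (t - t'));
  case: (Rle_dec s s'); case: (Rle_dec t t') => ? ? ? ? ? ? [?|?] [?|?] [?|?]; lra.
Qed.

(* For r in [-1, 1] the value of up lies between 1 and 17. *)
Definition grid (r : R) : 'I_18 := inord (Z.to_nat (up (8 * (r + 1))%Re)).

Lemma grid_close r r' : (-1 <= r <= 1)%Re -> (-1 <= r' <= 1)%Re ->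
  grid r = grid r' -> (Rabs (r - r') <= / 8)%Re.
Proof.
have gridE q : (-1 <= q <= 1)%Re ->
    nat_of_ord (grid q) = Z.to_nat (up (8 * (q + 1))%Re) /\ (0 <= up (8 * (q + 1))%Re)%Z.
  move=> q1; have [ub lb] := archimed (8 * (q + 1))%Re.
  have up0 : (0 <= up (8 * (q + 1))%Re)%Z by apply: le_IZR; lra.
  have up17 : (up (8 * (q + 1))%Re <= 17)%Z by apply: le_IZR; lra.
  by rewrite inordK //; apply/ltP; lia.
move=> /gridE[E up0] /gridE[E' up0'] /(congr1 (@nat_of_ord _)).
rewrite E E' => /(Z2Nat.inj _ _ up0 up0') Eup.
have [ub lb] := archimed (8 * (r + 1))%Re.
have [ub' lb'] := archimed (8 * (r' + 1))%Re.
rewrite -Eup in ub' lb'; apply: Rabs_le; lra.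
Qed.

(** * Classes of crossings *)

Definition cell : Type := 'I_18 * 'I_18 * 'I_18 * bool.

(** Here [ef] is the edge charged and [ab] the longer edge. The class records the position on [ef],
    the unit direction of [ab], and the half of [ab] that is hit. It is a relation because
    [segs_meet] only asserts that parameters exist. *)
Definition crossing_cell (e f a b : point) (k : cell) : Prop :=
  exists s t : R, (0 <= s <= 1)%Re /\ (0 <= t <= 1)%Re /\
    (fst e + s * (fst f - fst e) = fst a + t * (fst b - fst a))%Re /\
    (snd e + s * (snd f - snd e) = snd a + t * (snd b - snd a))%Re /\
    k = (grid s, grid ((fst b - fst a) / edist a b)%Re,
         grid ((snd b - snd a) / edist a b)%Re,
         `[< (t <= / 2)%Re >]).

Lemma crossing_cell_exists e f a b :
  segs_meet e f a b -> exists k, crossing_cell e f a b k.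
Proof.
case=> s [t [s0 [s1 [t0 [t1 [E1 E2]]]]]].
by eexists; exists s, t; split; [lra|split; [lra|split; [|split]]].
Qed.

Lemma len_div x y l : (0 < l)%Re -> len x y = l ->
  (len (x / l) (y / l) = 1 /\ -1 <= x / l <= 1 /\ -1 <= y / l <= 1)%Re.
Proof.
move=> l0 E.
have E1 : len (x / l)%Re (y / l)%Re = 1%Re.
  rewrite /Rdiv ![(_ * / l)%Re]Rmult_comm lenZ ?E; first by field; lra.
  by have := Rinv_0_lt_compat _ l0; lra.
have [xl [yl _]] := len_bounds (x / l)%Re (y / l)%Re.
rewrite E1 in xl yl; split=> //.
by move: xl yl; rewrite /Rabs; case: Rcase_abs; case: Rcase_abs; lra.
Qed.

(** Equal classes put the crossing points within [|ef| / 8] of each other and the unit directions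
    within [1/4]. Then [len_rays] bounds [ac] and [bd], and [no_parallel_edges] applies. *)
Lemma crossing_cell_exchange e f a b c d k :
  crossing_cell e f a b k -> crossing_cell e f c d k -> (0 < edist e f)%Re ->
  (edist e f <= edist a b)%Re -> (edist e f <= edist c d)%Re ->
  (edist a b <= edist a c)%Re \/ (edist a b <= edist b d)%Re ->
  (edist c d <= edist a c)%Re \/ (edist c d <= edist b d)%Re -> False.
Proof.
move=> [s [t [s01 [t01 [E1 [E2 ->]]]]]] [s' [t' [s01' [t01' [E1' [E2' [gs gu1 gu2 gt]]]]]]].
move=> l0 lab lcd; have /= := no_parallel_edges l0.
set l := edist e f in l0 lab lcd *.
set L := edist a b in lab gu1 gu2 *; set L' := edist c d in lcd gu1 gu2 *.
have [u1 [u2 u3]] : (len ((fst b - fst a) / L) ((snd b - snd a) / L) = 1 /\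
   -1 <= (fst b - fst a) / L <= 1 /\ -1 <= (snd b - snd a) / L <= 1)%Re.
  by apply: len_div; [lra|rewrite /L edist_sym].
have [v1 [v2 v3]] : (len ((fst d - fst c) / L') ((snd d - snd c) / L') = 1 /\
   -1 <= (fst d - fst c) / L' <= 1 /\ -1 <= (snd d - snd c) / L' <= 1)%Re.
  by apply: len_div; [lra|rewrite /L' edist_sym].
have {}gu1 := grid_close u2 v2 gu1.
have {}gu2 := grid_close u3 v3 gu2.
have {}gs : (Rabs (s - s') <= / 8)%Re by apply: grid_close gs; lra.
have Eb1 : (fst b - fst a = L * ((fst b - fst a) / L))%Re by field; lra.
have Eb2 : (snd b - snd a = L * ((snd b - snd a) / L))%Re by field; lra.
have Ed1 : (fst d - fst c = L' * ((fst d - fst c) / L'))%Re by field; lra.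
have Ed2 : (snd d - snd c = L' * ((snd d - snd c) / L'))%Re by field; lra.
move: Eb1 Eb2 Ed1 Ed2 u1 v1 gu1 gu2; clear u2 u3 v2 v3.
set U1 := ((fst b - fst a) / L)%Re; set U2 := ((snd b - snd a) / L)%Re.
set V1 := ((fst d - fst c) / L')%Re; set V2 := ((snd d - snd c) / L')%Re.
move=> Eb1 Eb2 Ed1 Ed2 u1 v1 gu1 gu2.
(* Each coordinate contributes at most [1/8]. *)
have uv : (len (U1 - V1) (U2 - V2) <= / 4)%Re.
  by have [_ [_]] := len_bounds (U1 - V1)%Re (U2 - V2)%Re; lra.
have xy : (len ((s - s') * (fst f - fst e)) ((s - s') * (snd f - snd e)) <= l / 8)%Re.
  have -> : l = len (fst f - fst e)%Re (snd f - snd e)%Re by rewrite /l edist_sym.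
  have l0' : (0 < len (fst f - fst e) (snd f - snd e))%Re by rewrite -edistE edist_sym.
  move: gs; rewrite /Rabs; case: Rcase_abs => ss gs; last by rewrite lenZ; nra.
  by rewrite -lenN !Ropp_mult_distr_l lenZ; nra.
move/(_ (t * L) ((1 - t) * L) (t' * L') ((1 - t') * L') (edist a c) (edist b d))%Re.
have -> : (t * L + (1 - t) * L = L)%Re by ring.
have -> : (t' * L' + (1 - t') * L' = L')%Re by ring.
move=> H hac hbd; apply: H => //; try nra.
(* From the crossing points, [a] and [c] are reached against the edge directions, hence the negated
   vectors. *)
- rewrite edistE.
  replace (fst a - fst c)%Re with
    ((s - s') * (fst f - fst e) + (t * L * - U1 - t' * L' * - V1))%Re.
    replace (snd a - snd c)%Re with
      ((s - s') * (snd f - snd e) + (t * L * - U2 - t' * L' * - V2))%Re.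
      apply: Rle_trans (len_rays _ _ _ _ _ _ _) _; rewrite ?lenN; try nra.
      replace (- U1 - - V1)%Re with (- (U1 - V1))%Re by ring.
      by replace (- U2 - - V2)%Re with (- (U2 - V2))%Re by ring; rewrite lenN.
    by rewrite Eb2 in E2; rewrite Ed2 in E2'; lra.
  by rewrite Eb1 in E1; rewrite Ed1 in E1'; lra.
- rewrite edistE.
  replace (fst b - fst d)%Re with
    ((s - s') * (fst f - fst e) + ((1 - t) * L * U1 - (1 - t') * L' * V1))%Re.
    replace (snd b - snd d)%Re with
      ((s - s') * (snd f - snd e) + ((1 - t) * L * U2 - (1 - t') * L' * V2))%Re.
      by apply: Rle_trans (len_rays _ _ _ _ _ _ _) _; try nra.
    by rewrite Eb2 in E2; rewrite Ed2 in E2'; lra.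
  by rewrite Eb1 in E1; rewrite Ed1 in E1'; lra.
- have : (t <= / 2 /\ t' <= / 2 \/ / 2 <= t /\ / 2 <= t')%Re.
    case: (Rle_dec t (/ 2)) => t2.
      by left; split=> //; apply/asboolP; rewrite -gt; apply/asboolP.
    right; split; first lra.
    by apply: Rnot_lt_le => t2'; apply: t2; apply/asboolP; rewrite gt; apply/asboolP; lra.
  by case=> -[h1 h2]; [left|right]; split; nra.
Qed.

(** * Counting crossings *)

Section Count.
Variables (n : nat) (p : 'I_n -> point).
Hypothesis p_inj : injective p.
Implicit Types (T : {set {set 'I_n}}) (X : {set 'I_n}).

(** This is the set that [crossings] counts. *)
Definition crossing_pairs T1 T2 : {set ('I_n * 'I_n) * ('I_n * 'I_n)} :=
  [set q : ('I_n * 'I_n) * ('I_n * 'I_n) | [&& q.1.1 < q.1.2, [set q.1.1; q.1.2] \in T1,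
               q.2.1 < q.2.2, [set q.2.1; q.2.2] \in T2 &
              `[< segs_meet (p q.1.1) (p q.1.2) (p q.2.1) (p q.2.2) >] ]].

Definition short_crossing_pairs T1 T2 :=
  [set q in crossing_pairs T1 T2 |
     `[< (edist (p q.1.1) (p q.1.2) <= edist (p q.2.1) (p q.2.2))%Re >]].

(** A crossing is determined by its shorter edge and its class: two longer edges sharing both would
    contradict [crossing_cell_exchange]. *)
Lemma card_short_crossing_pairs T1 T2 X : is_MST p X T2 ->
  #|short_crossing_pairs T1 T2| <= #|T1| * #|{: cell}|.
Proof.
move=> mst; set S := short_crossing_pairs _ _.
have /choice[code codeP] : forall q, exists k, q \in S ->
    crossing_cell (p q.1.1) (p q.1.2) (p q.2.1) (p q.2.2) k.
  (* Outside [S] the class is an arbitrary default. *)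
  move=> q; case: (boolP (q \in S)) => [|_]; last by exists (ord0, ord0, ord0, true).
  rewrite !inE => /andP[/and5P[_ _ _ _ /asboolP/crossing_cell_exists[k kP]] _].
  by exists k.
pose h (q : ('I_n * 'I_n) * ('I_n * 'I_n)) := ([set q.1.1; q.1.2], code q).
have h_inj : {in S &, injective h}.
  move=> q r qS rS; have := codeP r rS; have := codeP q qS.
  move: qS rS; rewrite !inE /h.
  move=> /andP[/and5P[e12 _ ab abT _] /asboolP lab].
  move=> /andP[/and5P[e12' _ cd cdT _] /asboolP lcd] kab kcd [eE kE].
  rewrite -{}kE in kcd; move: kab kcd.
  have {eE} := set2_ltn_inj e12 e12' eE.
  case: q r e12 ab abT lab e12' cd cdT lcd => [[e f] [a b]] [[e' f'] [c d]] /=.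
  move=> ef ab abT lab _ cd cdT lcd /[swap] /[swap] -[? ?]; subst e' f' => kab kcd.
  congr pair; apply: (set2_ltn_inj ab cd).
  have [//|ne] := eqVneq [set a; b] [set c; d].
  exfalso; apply: (crossing_cell_exchange kab kcd) => //.
  - by apply: edist_pos => /p_inj E; rewrite E ltnn in ef.
  - exact: (MST_exchange mst abT cdT).
  - rewrite (edist_sym (p a)) (edist_sym (p b)).
    by apply: (MST_exchange mst cdT abT); rewrite eq_sym.
rewrite -(card_in_imset h_inj) -[#|{: cell}|]cardsT -cardsX.
apply: subset_leq_card; apply/subsetP=> _ /imsetP[q qS ->].
by move: qS; rewrite !inE andbT => /andP[/and5P[]].
Qed.

Lemma crossings_le T1 T2 X1 X2 : is_MST p X1 T1 -> is_MST p X2 T2 ->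
  crossings p T1 T2 <= (#|T1| + #|T2|) * #|{: cell}|.
Proof.
move=> mst1 mst2; pose swap (q : ('I_n * 'I_n) * ('I_n * 'I_n)) := (q.2, q.1).
have swap_inj : injective swap by move=> [? ?] [? ?] [-> ->].
(* Each crossing is charged to its shorter edge; if that edge lies in [T2], the trees swap roles. *)
have sub : crossing_pairs T1 T2 \subset
    short_crossing_pairs T1 T2 :|: swap @: short_crossing_pairs T2 T1.
  apply/subsetP=> q qS; rewrite !inE; move: (qS); rewrite inE => ->.
  case: (Rle_dec (edist (p q.1.1) (p q.1.2)) (edist (p q.2.1) (p q.2.2))) => [le|nle].
    by apply/orP; left; apply/asboolP.
  apply/orP; right; apply/imsetP; exists (swap q); last by case: (q).
  move: qS; rewrite !inE => /and5P[-> -> -> -> /asboolP[s [t [? [? [? [? [? ?]]]]]]]] /=.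
  by apply/andP; split; apply/asboolP; [exists t, s|exact/Rlt_le/Rnot_le_lt].
apply: leq_trans (subset_leq_card sub) _.
apply: leq_trans (leq_card_setU _ _) _.
rewrite mulnDl leq_add ?card_imset //.
  exact: card_short_crossing_pairs mst2.
exact: card_short_crossing_pairs mst1.
Qed.

End Count.

(* cr(P) < c n, i.e. for every coloring P = R ∪ B (R = Rc, B = ~: Rc) the
   number of crossings between the MSTs T_R and T_B is < c n. *)
Theorem theorem1 :
  exists c : R, Rlt R0 c /\
    forall (n : nat) (p : 'I_n -> point), (0 < n)%N -> generic p ->
      forall (Rc : {set 'I_n}) (TR TB : {set {set 'I_n}}),
        is_MST p Rc TR -> is_MST p (~: Rc) TB ->
        Rlt (INR (crossings p TR TB)) (Rmult c (INR n)).
Proof.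
(* The extra one makes the inequality strict, as [0 < n]. *)
exists (INR #|{: cell}|.+1); split; first by apply: lt_0_INR; apply/ltP.
move=> n p n0 [[p_inj _] _] Rc TR TB mstR mstB.
rewrite -mult_INR; apply: lt_INR; apply/ltP; rewrite multE.
apply: leq_ltn_trans (crossings_le p_inj mstR mstB) _.
(* The colour classes partition the points, and each tree has at most as many edges as vertices,
   even on an empty class. *)
have TRB : #|TR| + #|TB| <= n.
  have [[_ [-> _]] _] := mstR; have [[_ [-> _]] _] := mstB.
  by rewrite -[leqRHS](card_ord n) -(cardsC Rc) leq_add // leq_pred.
by rewrite mulSn mulnC -[ltnLHS]add0n -addSn leq_add // leq_mul.
Qed.
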